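(* Let $(\Gamma,<)$ be an ordered set and let $\Delta \subsetneq \Gamma$ be a non-trivial (i.e. non-empty) proper $\mathcal{L}_<$-definable final segment. Assume that $\Gamma$ is dense or discrete. Then there is $\gamma \in \Gamma$ such that $\Delta = \gamma_-$ or $\Delta = \gamma_+$.
   Context: All orderings are linear. $\mathcal{L}_<=\{<\}$ is the language of ordered sets, and ''definable'' means first-order definable with parameters from the structure. A final segment of $\Gamma$ is a subset $\Delta$ such that $a\in\Delta$, $b\in\Gamma$, $a<b$ imply $b\in\Delta$. An element $b$ is the successor of $a$ (and $a$ the predecessor of $b$) if $a<b$ and there is no $c$ with $a<c<b$. $(\Gamma,<)$ is dense if no element has a successor; it is discrete if for any $a<b$ in $\Gamma$ there exist a successor of $a$ and a predecessor of $b$. For $\gamma\in\Gamma$: $\gamma_-:=\{i\in\Gamma\mid \gamma\le i\}$ and $\gamma_+:=\{i\in\Gamma\mid\gamma<i\}$. *)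

(* Defs.v *)
From HB Require Import structures.
From mathcomp Require Import all_boot all_order.
From mathcomp Require Import boolp classical_sets.
Set Implicit Arguments.
Unset Strict Implicit.
Unset Printing Implicit Defensive.
Import Order.TTheory.
Local Open Scope order_scope.
Local Open Scope classical_set_scope.

(* First-order formulas of the language {<} (with equality) whose free
   variables are among those indexed by 'I_n. Variables are de Bruijn indices:
   the variable bound by [FExists] is [ord0] in its body. The remaining
   connectives and the universal quantifier are the usual classical
   abbreviations. *)
Inductive formula : nat -> Type :=
| FEq n (i j : 'I_n) : formula n
| FLt n (i j : 'I_n) : formula n
| FNot n (f : formula n) : formula n
| FAnd n (f g : formula n) : formula n
| FExists n (f : formula n.+1) : formula n.

Fixpoint holds d (G : orderType d) n (f : formula n) : n.-tuple G -> Prop :=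
  match f in formula m return m.-tuple G -> Prop with
  | FEq _ i j => fun v => tnth v i = tnth v j
  | FLt _ i j => fun v => tnth v i < tnth v j
  | FNot _ f1 => fun v => ~ holds f1 v
  | FAnd _ f1 f2 => fun v => holds f1 v /\ holds f2 v
  | FExists _ f1 => fun v => exists x : G, holds f1 [tuple of x :: v]
  end.

(* The tuple [a] lists the parameters. *)
Definition definable d (G : orderType d) (D : set G) : Prop :=
  exists n (f : formula n.+1) (a : n.-tuple G),
    D = [set x | holds f [tuple of x :: a]].

Definition final_segment d (G : orderType d) (D : set G) : Prop :=
  forall a b : G, D a -> a < b -> D b.

(* [successor a b]: b is the successor of a, equivalently a is the predecessor
   of b. *)
Definition successor d (G : orderType d) (a b : G) : Prop :=
  a < b /\ ~ (exists c : G, a < c /\ c < b).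

Definition dense_order d (G : orderType d) : Prop :=
  forall a : G, ~ (exists b : G, successor a b).

Definition discrete_order d (G : orderType d) : Prop :=
  forall a b : G, a < b ->
    (exists s : G, successor a s) /\ (exists p : G, successor p b).

Definition seg_minus d (G : orderType d) (g : G) : set G := [set i | g <= i].

Definition seg_plus d (G : orderType d) (g : G) : set G := [set i | g < i].

(* Main.v *)
(* If neither side of the cut has an endpoint, points x outside and y inside
   Delta can be chosen arbitrarily many steps away from a pair A < B separating
   them from all the parameters. In the Ehrenfeucht-Fraisse game moves outside
   [A, B] are copied; inside, it suffices to preserve step counts truncated at
   2^k with k rounds left, because a gap that is too long can be split the same
   way on both sides. So x and y satisfy the same formulas of bounded depth. *)

Require Import Defs.
From mathcomp Require Import all_boot all_order.
From mathcomp Require Import boolp classical_sets.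
Set Implicit Arguments.
Unset Strict Implicit.
Unset Printing Implicit Defensive.
Import Order.TTheory.
Local Open Scope order_scope.
Local Open Scope classical_set_scope.

(** * Step counts in a linear order *)

(** For [a <= b] this measures whether the interval [(a, b]] has at least [m] points. Ending the
    chain with [<=] makes the property persist when [a] or [m] decreases or [b] increases. *)
Fixpoint steps d (G : orderType d) (m : nat) (a b : G) : Prop :=
  if m is m'.+1 then exists2 c, a < c & steps m' c b else a <= b.

Lemma steps_le d (G : orderType d) m (a b : G) : steps m a b -> a <= b.
Proof. by elim: m a => //= m IH a [c /ltW ac /IH]; apply: le_trans. Qed.

Lemma le_steps d (G : orderType d) m (a b c : G) :
  a <= b -> steps m b c -> steps m a c.
Proof.
case: m => [|m] /= ab; first exact: le_trans.
by case=> x bx xc; exists x => //; apply: le_lt_trans bx.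
Qed.

Lemma stepsW d (G : orderType d) m n (a b : G) :
  (m <= n)%N -> steps n a b -> steps m a b.
Proof.
elim: m n a => [|m IH] [|n] a //=.
  by move=> _ [c /ltW ac /steps_le]; apply: le_trans.
by move=> mn [c ac cb]; exists c => //; apply: IH cb.
Qed.

Lemma steps_trans d (G : orderType d) m n (a b c : G) :
  steps m a b -> steps n b c -> steps (m + n) a c.
Proof.
elim: m a => [|m IH] a /=; first exact: le_steps.
by case=> x ax xb bc; exists x => //; apply: IH.
Qed.

Lemma steps_split d (G : orderType d) m n (a b : G) :
  steps (m + n) a b -> exists2 c, steps m a c & steps n c b.
Proof.
elim: m a => [|m IH] a /=; first by exists a.
by case=> x ax /IH [c xc cb]; exists c => //; exists x.
Qed.

(** The first point of a chain beyond [b] can also be reached from [b] in one step, so inserting [b]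
    loses no step. *)
Lemma steps_through d (G : orderType d) m (a b c : G) : a <= b -> b <= c ->
  steps m a c <-> exists i j, [/\ (i + j)%N = m, steps i a b & steps j b c].
Proof.
move=> ab bc; split; last by move=> [i [j [<-]]]; apply: steps_trans.
elim: m a ab => [|m IH] a ab /=; first by exists 0, 0.
case=> x ax xc; have [xb|bx] := leP x b.
  have [i [j [<- xb' bc']]] := IH _ xb xc.
  by exists i.+1, j; split => //; exists x.
by exists 0, m.+1; split => //; exists x.
Qed.

Lemma stepsxx d (G : orderType d) m (a : G) : steps m a a <-> m = 0.
Proof.
case: m => [|m] /=; first by rewrite lexx.
by split=> // -[c ac /steps_le]; rewrite leNgt ac.
Qed.

Lemma steps_gt d (G : orderType d) m (a b : G) : b < a -> ~ steps m a b.
Proof. by move=> ba /steps_le; rewrite leNgt ba. Qed.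

Lemma lt_steps1 d (G : orderType d) (a b : G) : a < b <-> steps 1 a b.
Proof. by split=> [ab|/= [c ac]]; [exists b => /= | apply: lt_le_trans]. Qed.

Lemma steps_dual d (G : orderType d) m (a b : G) :
  steps m (a : G^d) (b : G^d) <-> steps m b a.
Proof.
elim: m a => [|m IH] a; first by [].
rewrite -{2}addn1; split.
  case=> c /= ac /IH bc; apply: steps_trans bc _.
  by apply/lt_steps1.
case/steps_split=> c /IH bc /lt_steps1 ca; exists c => //.
Qed.

(** * Exact distances and their transfer between intervals *)

Definition exactly d (G : orderType d) (m : nat) (a b : G) : Prop :=
  steps m a b /\ ~ steps m.+1 a b.

Lemma exactlyP d (G : orderType d) m k (a b : G) :
  exactly m a b -> steps k a b <-> (k <= m)%N.
Proof.
case=> ab nab; split=> [kab|km]; last exact: stepsW km ab.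
by rewrite leqNgt; apply/negP => mk; apply: nab; apply: stepsW mk kab.
Qed.

Lemma exactly_dual d (G : orderType d) m (a b : G) :
  exactly m (a : G^d) (b : G^d) <-> exactly m b a.
Proof. by rewrite /exactly !steps_dual. Qed.

Lemma exactly_ex d (G : orderType d) N (a b : G) :
  a <= b -> ~ steps N a b -> exists2 m, (m < N)%N & exactly m a b.
Proof.
move=> ab; elim: N => [//|N IH] nN.
have [/IH [m mN ex]|/contrapT sN] := pselect (~ steps N a b).
  by exists m => //; apply: ltnW.
by exists N.
Qed.

(* What dense and discrete orders have in common: either all the non-maximal
   elements have a successor, or none does. *)
Definition succ_uniform d (G : orderType d) : Prop :=
  forall a a' b' : G, (exists s, successor a s) -> a' < b' ->
    exists s, successor a' s.

(** An exact distance is a chain of immediate successors. By uniformity it can be replayed from [a']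
    as long as the current point lies below another one, and moving by successors is the shortest
    way to move, so [n] steps remain. *)
Lemma exactly_transfer d (G : orderType d) t n (a c a' b' : G) :
  succ_uniform G -> exactly t a c -> steps (t + n) a' b' ->
  exists2 c', exactly t a' c' & steps n c' b'.
Proof.
move=> U; elim: t a a' => [|t IH] a a' [ac nac] a'b'.
  exists a' => //; split; first exact: lexx.
  by move/stepsxx.
case: ac => s as_ sc.
(* A point strictly between [a] and [s] would give a chain of [t.+2] steps. *)
have ss : successor a s.
  split=> // -[z [az zs]]; apply: nac; exists z => //.
  by exists s.
case: a'b' => z a'z zb'.
have [s' [a's' min]] := U a a' z (ex_intro _ s ss) a'z.
have s'z w : a' < w -> s' <= w.
  by move=> a'w; rewrite leNgt; apply/negP => ws'; apply: min; exists w.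
have es : exactly t s c by split=> // h; apply: nac; exists s.
have [c' [s'c' ns'c'] c'b'] := IH _ _ es (le_steps (s'z _ a'z) zb').
exists c' => //; split; first by exists s'.
by case=> w /s'z s'w wc'; apply: ns'c'; apply: (@le_steps _ _ t.+1) s'w wc'.
Qed.

(** The cases ask which sides of [c] have at least [N] steps. If both do, a chain of [N + N] steps
    is cut in the middle; if one is shorter, its exact length is copied from its end of the
    interval; if both are, the whole interval has an exact length. *)
Lemma interval_transfer d (G : orderType d) N (a b c a' b' : G) :
    succ_uniform G -> succ_uniform (G^d) -> a <= c -> c <= b ->
    (forall m, (m <= N + N)%N -> steps m a b <-> steps m a' b') ->
  exists c', forall m, (m <= N)%N ->
    (steps m a c <-> steps m a' c') /\ (steps m c b <-> steps m c' b').
Proof.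
move=> U Ud ac cb ab.
have [sac|nac] := pselect (steps N a c); have [scb|ncb] := pselect (steps N c b).
- have /steps_split[c' a'c' c'b'] : steps (N + N) a' b'.
    by apply/(ab _ (leqnn _)); apply: steps_trans scb.
  by exists c' => m mN; split; split=> _; apply: stepsW mN _.
- have [u uN ecb] := exactly_ex cb ncb.
  (* The short side is on the right, so successors are followed downwards from [b'], in the dual
     order. *)
  have edual : exactly u (b : G^d) c by apply/exactly_dual.
  have ub' : steps (u + N) (b' : G^d) (a' : G^d).
    apply/steps_dual/ab; first by rewrite leq_add2r ltnW.
    by rewrite addnC; apply: steps_trans sac ecb.1.
  have [c' /exactly_dual e' /steps_dual a'c'] := exactly_transfer Ud edual ub'.
  exists c' => m mN; split; first by split=> _; apply: stepsW mN _.
  by rewrite (exactlyP _ ecb) (exactlyP _ e').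
- have [t tN eac] := exactly_ex ac nac.
  have a'b' : steps (t + N) a' b'.
    apply/ab; first by rewrite leq_add2r ltnW.
    by apply: steps_trans scb; case: eac.
  have [c' e' c'b'] := exactly_transfer U eac a'b'.
  exists c' => m mN; split; last by split=> _; apply: stepsW mN _.
  by rewrite (exactlyP _ eac) (exactlyP _ e').
have [t tN eac] := exactly_ex ac nac; have [u uN ecb] := exactly_ex cb ncb.
(* The strict inequality lets the absence of [(t + u).+1] steps transfer too, so that neither half
   of the split of [a'], [b'] can be too long. *)
have tuN : (t + u < N + N)%N by rewrite -addnS leq_add // ltnW.
have nab : ~ steps (t + u).+1 a b.
  move/(steps_through _ ac cb) => [i [j [ij]]].
  move=> /(exactlyP _ eac) it /(exactlyP _ ecb) ju.
  by have := leq_add it ju; rewrite ij ltnn.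
have /steps_split[c' a'c' c'b'] : steps (t + u) a' b'.
  by apply/ab; [apply: ltnW | apply: steps_trans eac.1 ecb.1].
have na'b' : ~ steps (t + u).+1 a' b' by move/(ab _ tuN).
have e1 : exactly t a' c'.
  by split=> // h; apply: na'b'; rewrite -addSn; apply: steps_trans c'b'.
have e2 : exactly u c' b'.
  by split=> // h; apply: na'b'; rewrite -addnS; apply: steps_trans h.
exists c' => m mN.
by rewrite (exactlyP _ eac) (exactlyP _ e1) (exactlyP _ ecb) (exactlyP _ e2).
Qed.

(** * Finite partial maps preserving truncated step counts *)

(** A game position as a finite list of matched pairs. The case [m = 0] already makes it an order
    isomorphism. *)
Definition agree d (G : orderType d) (N : nat) (s : seq (G * G)) : Prop :=
  {in s &, forall p q, forall m, (m <= N)%N ->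
    steps m p.1 q.1 <-> steps m p.2 q.2}.

Lemma agreeW d (G : orderType d) M N (s : seq (G * G)) :
  (M <= N)%N -> agree N s -> agree M s.
Proof. by move=> MN H p q ps qs m mM; apply: H => //; apply: leq_trans MN. Qed.

Lemma agree_swap d (G : orderType d) N (s : seq (G * G)) :
  agree N s -> agree N [seq (p.2, p.1) | p <- s].
Proof.
move=> H _ _ /mapP[p ps ->] /mapP[q qs ->] m mN /=.
by split=> /(H _ _ ps qs _ mN).
Qed.

Lemma agree_le d (G : orderType d) N (s : seq (G * G)) p q :
  agree N s -> p \in s -> q \in s -> (p.1 <= q.1) = (p.2 <= q.2).
Proof. by move=> H ps qs; have [h1 h2] := H _ _ ps qs 0 isT; apply/idP/idP. Qed.

(** Every old point lies beyond [p] or [q], so its step counts to [c] split at that neighbour by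
    [steps_through]. *)
Lemma agree_cons d (G : orderType d) N (s : seq (G * G)) p q (c c' : G) :
    (0 < N)%N -> agree N s -> p \in s -> q \in s -> p.1 < c -> c < q.1 ->
    {in s, forall r, r.1 <= p.1 \/ q.1 <= r.1} ->
    (forall m, (m <= N)%N ->
      (steps m p.1 c <-> steps m p.2 c') /\ (steps m c q.1 <-> steps m c' q.2)) ->
  agree N ((c, c') :: s).
Proof.
move=> N0 H ps qs pc cq gap E.
(* Strict inequalities are counts of one step, hence visible because [0 < N]. *)
have p'c' : p.2 < c' by apply/lt_steps1/(E 1 N0).1/lt_steps1.
have c'q' : c' < q.2 by apply/lt_steps1/(E 1 N0).2/lt_steps1.
have parts i j m : (i + j)%N = m -> (m <= N)%N -> (i <= N)%N /\ (j <= N)%N.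
  by move=> <- ijN; split; apply: leq_trans ijN; rewrite ?leq_addl ?leq_addr.
have new r m : r \in s -> (m <= N)%N ->
    (steps m r.1 c <-> steps m r.2 c') /\ (steps m c r.1 <-> steps m c' r.2).
  move=> rs mN; case: (gap _ rs) => rle.
    have r'le : r.2 <= p.2 by rewrite -(agree_le H).
    split; last first.
      by split=> /steps_gt []; apply: le_lt_trans; eassumption.
    rewrite (steps_through _ rle (ltW pc)) (steps_through _ r'le (ltW p'c')).
    split=> -[i [j [ij h1 h2]]]; exists i, j; split=> //;
      have [iN jN] := parts _ _ _ ij mN;
      by [apply/(H _ _ rs ps i iN) | apply/(E j jN).1].
  have r'le : q.2 <= r.2 by rewrite -(agree_le H).
  split.
    by split=> /steps_gt []; apply: lt_le_trans; eassumption.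
  rewrite (steps_through _ (ltW cq) rle) (steps_through _ (ltW c'q') r'le).
  split=> -[i [j [ij h1 h2]]]; exists i, j; split=> //;
      have [iN jN] := parts _ _ _ ij mN;
    by [apply/(E i iN).2 | apply/(H _ _ qs rs j jN)].
move=> p1 p2; rewrite !inE => /orP[/eqP->|p1s] /orP[/eqP->|p2s] m mN /=.
- by rewrite !stepsxx.
- by have [] := new _ _ p2s mN.
- by have [] := new _ _ p1s mN.
- exact: H.
Qed.

(** A [key] with values in [G^d] turns the maximum into a minimum. *)
Lemma seq_max d (G : orderType d) (T : eqType) (key : T -> G) (P : T -> Prop)
    (s : seq T) x0 : x0 \in s -> P x0 ->
  exists x, [/\ x \in s, P x & {in s, forall y, P y -> key y <= key x}].
Proof.
elim: s x0 => // z s IH x0 x0s Px0.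
have [[x xs Px]|none] := pselect (exists2 x, x \in s & P x).
  have [y [ys Py ymax]] := IH x xs Px.
  have [[Pz yz]|nz] := pselect (P z /\ key y <= key z).
    exists z; split; rewrite ?mem_head // => w /predU1P[->//|ws Pw].
    exact: le_trans (ymax _ ws Pw) yz.
  exists y; split; rewrite ?inE ?ys ?orbT // => w /predU1P[->|ws] Pw;
    last exact: ymax.
  by rewrite leNgt; apply/negP => /ltW yz; apply: nz.
move: x0s; rewrite inE => /orP[/eqP x0z|x0s]; last by case: none; exists x0.
exists z; split; rewrite ?mem_head -?x0z // => w /predU1P[->//|ws] Pw.
by case: none; exists w.
Qed.

(** One move of the game: a new [c] is answered inside the gap between its nearest matched
    neighbours, at the price of halving the bound. *)
Lemma agree_extend d (G : orderType d) N (s : seq (G * G)) p0 q0 (c : G) :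
    succ_uniform G -> succ_uniform (G^d) -> (0 < N)%N -> agree (N + N) s ->
    p0 \in s -> q0 \in s -> p0.1 <= c -> c <= q0.1 ->
  exists c', agree N ((c, c') :: s).
Proof.
move=> U Ud N0 H p0s q0s p0c cq0.
have HN : agree N s by apply: agreeW H; rewrite leq_addr.
have dup r : r \in s -> r.1 = c -> exists c', agree N ((c, c') :: s).
  move=> rs rc; exists r.2; rewrite -rc -surjective_pairing => p q.
  by rewrite !inE => /predU1P[->|ps] /predU1P[->|qs] m mN; apply: HN.
have [p [ps pc pmax]] := seq_max (fun r : G * G => r.1)
  (P := fun r => r.1 <= c) p0s p0c.
have [q [qs cq qmin]] := seq_max (fun r : G * G => r.1 : G^d)
  (P := fun r => c <= r.1) q0s cq0.
have [pc'|] := eqVneq p.1 c; first exact: dup ps pc'.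
have [qc'|] := eqVneq q.1 c; first by move=> _; apply: dup qs qc'.
move=> qnc pnc.
have [c' E] := interval_transfer U Ud pc cq (H p q ps qs).
exists c'; apply: (agree_cons N0 HN ps qs _ _ _ E).
- by rewrite lt_neqAle pnc.
- by rewrite lt_neqAle eq_sym qnc.
move=> r rs; have [rc|cr] := leP r.1 c; first by left; apply: pmax.
by right; apply: (qmin _ rs); apply: ltW.
Qed.

(** * Back-and-forth for formulas of bounded quantifier depth *)

Fixpoint qdepth n (f : formula n) : nat :=
  match f with
  | FEq _ _ _ | FLt _ _ _ => 0
  | FNot _ g => qdepth g
  | FAnd _ g h => maxn (qdepth g) (qdepth h)
  | FExists _ g => (qdepth g).+1
  end.

Definition matched d (G : orderType d) (A B : G) (s : seq (G * G)) (u v : G) :=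
  u = v /\ (u < A \/ B < u) \/ (u, v) \in s.

Lemma matched_lt d (G : orderType d) N (A B : G) s (u v u' v' : G) :
    agree N.+1 s -> (A, A) \in s -> (B, B) \in s ->
    {in s, forall p, A <= p.1 <= B} ->
    matched A B s u v -> matched A B s u' v' -> u < u' <-> v < v'.
Proof.
move=> H As Bs win.
(* Since [A] and [B] are matched to themselves, partners of points in the window stay in it. *)
have win2 p : p \in s -> A <= p.2 <= B.
  by move=> ps; rewrite -(agree_le H As ps) -(agree_le H ps Bs) win.
have out w p : p \in s -> w < A \/ B < w ->
    (w < p.1 <-> w < p.2) /\ (p.1 < w <-> p.2 < w).
  move=> ps; have /andP[a1 b1] := win _ ps; have /andP[a2 b2] := win2 _ ps.
  case=> [wA|Bw].
    have [h1 h2] := (lt_le_trans wA a1, lt_le_trans wA a2).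
    by rewrite h1 h2 (lt_gtF h1) (lt_gtF h2).
  have [h1 h2] := (le_lt_trans b1 Bw, le_lt_trans b2 Bw).
  by rewrite h1 h2 (lt_gtF h1) (lt_gtF h2).
move=> [[<- uo]|uv] [[<- uo']|uv'] //.
- by have [] := out _ _ uv' uo.
- by have [] := out _ _ uv uo'.
- by rewrite !lt_steps1; apply: (H _ _ uv uv' 1).
Qed.

Lemma matched_swap d (G : orderType d) (A B : G) s (u v : G) :
  matched A B s u v -> matched A B [seq (p.2, p.1) | p <- s] v u.
Proof.
case=> [[<- o]|uv]; first by left.
by right; apply/mapP; exists (u, v).
Qed.

(** Induction on [f]: each quantifier is one move and halves the bound, whence [2 ^ k]. *)
Lemma holds_matched d (G : orderType d) (A B : G) n (f : formula n) k s
    (u v : n.-tuple G) :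
    succ_uniform G -> succ_uniform (G^d) -> (qdepth f <= k)%N ->
    agree (2 ^ k) s -> (A, A) \in s -> (B, B) \in s ->
    {in s, forall p, A <= p.1 <= B} ->
    (forall i, matched A B s (tnth u i) (tnth v i)) ->
  holds f u <-> holds f v.
Proof.
move=> U Ud; elim: f k s u v => {n} /=.
- move=> n i j k s u v _ H As Bs win uv.
  rewrite -(prednK (expn_gt0 2 k)) in H.
  (* Equality is the failure of both strict inequalities. *)
  have ij := matched_lt H As Bs win (uv i) (uv j).
  have ji := matched_lt H As Bs win (uv j) (uv i).
  split=> e; apply/eqP; rewrite eq_le !leNgt; apply/andP; split; apply/negP.
  + by move/ji; rewrite e ltxx.
  + by move/ij; rewrite e ltxx.
  + by move/ji; rewrite e ltxx.
  + by move/ij; rewrite e ltxx.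
- move=> n i j k s u v _ H As Bs win uv.
  rewrite -(prednK (expn_gt0 2 k)) in H.
  exact: matched_lt H As Bs win (uv i) (uv j).
- by move=> n f IH k s u v fk H As Bs win uv; rewrite (IH k s u v).
- move=> n f IHf g IHg k s u v; rewrite geq_max => /andP[fk gk] H As Bs win uv.
  by rewrite (IHf k s u v) // (IHg k s u v).
move=> n f IH [//|k] s u v fk.
(* One direction for an arbitrary position; the converse applies it to the position with all pairs
   swapped. *)
have half s' (u' v' : n.-tuple G) :
    agree (2 ^ k.+1) s' -> (A, A) \in s' -> (B, B) \in s' ->
    {in s', forall p, A <= p.1 <= B} ->
    (forall i, matched A B s' (tnth u' i) (tnth v' i)) ->
    (exists x, holds f [tuple of x :: u']) -> exists x, holds f [tuple of x :: v'].
  rewrite expnS mul2n -addnn => H As Bs win uv [c fc].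
  have cons_matched s2 c' : {subset s' <= s2} -> matched A B s2 c c' ->
      forall i, matched A B s2 (tnth [tuple of c :: u'] i) (tnth [tuple of c' :: v'] i).
    move=> ss cc i; case: (unliftP ord0 i) => [j|] ->; last by rewrite !tnth0.
    by rewrite !tnthS; case: (uv j) => [|/ss]; [left | right].
  have [o|nout] := pselect (c < A \/ B < c).
    exists c; apply: (iffLR (IH k s' _ _ _ _ _ _ _ _)) fc => //.
    - by apply: agreeW H; rewrite leq_addr.
    - by apply: cons_matched => //; left.
  have Ac : A <= c by rewrite leNgt; apply/negP => h; apply: nout; left.
  have cB : c <= B by rewrite leNgt; apply/negP => h; apply: nout; right.
  have [c' H'] := agree_extend U Ud (expn_gt0 2 k) H As Bs Ac cB.
  exists c'; apply: (iffLR (IH k ((c, c') :: s') _ _ _ _ _ _ _ _)) fc => //.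
  - by rewrite inE As orbT.
  - by rewrite inE Bs orbT.
  - by move=> p /predU1P[->|/win //]; rewrite Ac.
  - apply: cons_matched => [p ps|]; first by rewrite inE ps orbT.
    by right; rewrite mem_head.
move=> H As Bs win uv; split; first exact: half uv.
have inswap a b : ((a, b) \in s) -> ((b, a) \in [seq (p.2, p.1) | p <- s]).
  by move=> ab; apply/mapP; exists (a, b).
apply: (half [seq (p.2, p.1) | p <- s]) => //; try exact: inswap.
- exact: agree_swap.
- by move=> _ /mapP[p ps ->] /=; rewrite -(agree_le H As ps) -(agree_le H ps Bs) win.
- by move=> i; apply: matched_swap.
Qed.

(** * Definable cuts *)

Lemma succ_uniform_dense_or_discrete d (G : orderType d) :
  dense_order G \/ discrete_order G -> succ_uniform G /\ succ_uniform (G^d).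
Proof.
have dual (a b : G) : successor (a : G^d) b <-> successor b a.
  by split=> -[ab h]; split=> // -[c [h1 h2]]; apply: h; exists c.
move=> [D|D]; split=> a a' b'.
- by move/D.
- by case=> s /dual sa; case: (D s); exists a.
- by move=> _ /D[].
- by move=> _ /D[_ [s sa]]; exists s; apply/dual.
Qed.

Lemma cut_not_definable d (G : orderType d) (D : set G) :
    succ_uniform G -> succ_uniform (G^d) -> definable D -> final_segment D ->
    D !=set0 -> ~` D !=set0 ->
    (forall a, D a -> exists2 b, D b & b < a) ->
    (forall a, ~ D a -> exists2 b, ~ D b & a < b) ->
  False.
Proof.
move=> U Ud [n [f [a Df]]] fin [b0 Db0] [a0 Da0] nomin nomax.
have lt_cut x y : ~ D x -> D y -> x < y.
  move=> Dx Dy; rewrite ltNge le_eqVlt; apply/negP => /predU1P[e|yx].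
    by apply: Dx; rewrite -e.
  by apply: Dx; apply: fin yx.
(* [A] and [B] are the points nearest to the cut among the parameters; adding [a0] and [b0] ensures
   that both exist. *)
have [A [_ DA Amax]] := seq_max (id : G -> G) (P := fun x => ~ D x)
  (mem_head a0 a) Da0.
have [B [_ DB Bmin]] := seq_max (id : G -> G^d) (P := D)
  (mem_head b0 a) Db0.
have up m x : ~ D x -> exists2 y, ~ D y & steps m x y.
  elim: m x => [|m IH] x Dx; first by exists x => //=.
  have [y Dy xy] := nomax _ Dx; have [z Dz yz] := IH _ Dy.
  by exists z => //; exists y.
have down m x : D x -> exists2 y, D y & steps m y x.
  elim: m x => [|m IH] x Dx; first by exists x => //=.
  have [y Dy yx] := nomin _ Dx; have [z Dz zy] := IH _ Dy.
  by exists z => //; rewrite -addn1; apply: steps_trans zy _; apply/lt_steps1.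
pose N := (2 ^ qdepth f)%N; have N0 : (0 < N)%N by rewrite expn_gt0.
(* Both [x] and [y] are at least [N] steps from [A] and from [B], so all counts up to [N] agree. *)
have [x Dx Ax] := up N A DA; have [y Dy yB] := down N B DB.
have xB : steps N x B := le_steps (ltW (lt_cut _ _ Dx Dy)) yB.
have Ay : steps N A y.
  by have := steps_trans Ax (ltW (lt_cut _ _ Dx Dy) : steps 0 x y); rewrite addn0.
pose s := [:: (x, y); (A, A); (B, B)].
have As : (A, A) \in s by rewrite !inE eqxx orbT.
have Bs : (B, B) \in s by rewrite !inE eqxx !orbT.
have H0 : agree N [:: (A, A); (B, B)].
  by move=> p q; rewrite !inE => /orP[]/eqP-> /orP[]/eqP->.
have H : agree N s.
  apply: (agree_cons N0 H0 (p := (A, A)) (q := (B, B))) => /=.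
  - exact: mem_head.
  - by rewrite !inE eqxx orbT.
  - by apply/lt_steps1; apply: stepsW N0 Ax.
  - exact: lt_cut.
  - by move=> r; rewrite !inE => /orP[]/eqP->; [left | right]; apply: lexx.
  - by move=> m mN; split; split=> _; apply: stepsW mN _.
have /iffLR : holds f [tuple of y :: a] <-> holds f [tuple of x :: a].
  apply: iff_sym; apply: (holds_matched U Ud (leqnn _) H As Bs).
    have := (steps_le Ax, steps_le xB, ltW (lt_cut _ _ DA DB)).
    by move=> [[hA hB] AB] p; rewrite !inE => /or3P[]/eqP-> /=; apply/andP.
  move=> i; case: (unliftP ord0 i) => [j|] ->; last first.
    by rewrite !tnth0; right; apply: mem_head.
  rewrite !tnthS; have ja : tnth a j \in (a : seq G) := mem_tnth j a.
  (* No parameter lies strictly between [A] and [B]: each is an endpoint or lies outside the window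
     and is copied. *)
  have [Dj|nDj] := pselect (D (tnth a j)).
    have : B <= tnth a j by apply: (Bmin _ _ Dj); rewrite inE ja orbT.
    by rewrite le_eqVlt => /predU1P[<-|]; [right | left; split; [|right]].
  have : tnth a j <= A by apply: Amax => //; rewrite inE ja orbT.
  by rewrite le_eqVlt => /predU1P[->|]; [right | left; split; [|left]].
by move=> yx; apply: Dx; rewrite Df; apply: yx; move: Dy; rewrite Df.
Qed.

Theorem lemma6p2 (d : Order.disp_t) (Gamma : orderType d) (Delta : set Gamma)
    (Delta_nonempty : Delta !=set0)
    (Delta_proper : Delta `<` [set: Gamma])
    (Delta_definable : definable Delta)
    (Delta_final : final_segment Delta)
    (Gamma_dense_or_discrete : dense_order Gamma \/ discrete_order Gamma) :
  exists gamma : Gamma, Delta = seg_minus gamma \/ Delta = seg_plus gamma.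
Proof.
have [U Ud] := succ_uniform_dense_or_discrete Gamma_dense_or_discrete.
have proper : ~` Delta !=set0.
  case: Delta_proper => [_ nT]; apply: contrapT => none; apply: nT => x _.
  by apply: contrapT => Dx; apply: none; exists x.
apply: contrapT => none.
(* A least element of [Delta] would give [seg_minus], a greatest element of its complement
   [seg_plus]. *)
apply: (cut_not_definable U Ud Delta_definable) => // g Dg;
  apply: contrapT => ext; apply: none; exists g.
- left; apply/seteqP; split=> x /=.
    move=> Dx; rewrite /seg_minus /= leNgt; apply/negP => xg.
    by apply: ext; exists x.
  by rewrite /seg_minus /= le_eqVlt => /predU1P[<-//|]; apply: Delta_final.
- right; apply/seteqP; split=> x /=.
    move=> Dx; rewrite /seg_plus /= ltNge le_eqVlt; apply/negP => /predU1P[xg|xg].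
      by apply: Dg; rewrite -xg.
    by apply: Dg; apply: Delta_final xg.
  move=> gx; apply: contrapT => Dx; apply: ext; by exists x.
Qed.
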